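(* The map $\rho_{\mathbb{O}}$ extends to a group homomorphism $$\Gamma_{\mathbb{O}}:\widehat{Spin(9)}\to SO(\mathbb{R}\oplus\mathbb{O})=SO(9),\qquad \Gamma_{\mathbb{O}}(g(r,u))=\rho_{\mathbb{O}}(r,u)\ \text{ for all } r\in\mathbb{R},\,u\in\mathbb{O}\text{ with } r^2+|u|^2=1.$$ Moreover $\Gamma_{\mathbb{O}}$ is onto and $\Gamma_{\mathbb{O}}^{-1}(I_9)=\{\pm \mathrm{Id}\}$; hence $\Gamma_{\mathbb{O}}$ is a $2$-fold covering of $SO(\mathbb{R}\oplus\mathbb{O})$.
   Context: $\mathbb{O}$ is the normed division algebra of octonions with inner product $\langle x,y\rangle=\mathrm{Re}(x\bar y)$; $\mathbb{R}\oplus\mathbb{O}\cong\mathbb{R}^9$ has the Euclidean inner product. $\widehat{Spin(9)}\cong Spin(9)$ is the subgroup of $\mathrm{End}_{\mathbb{R}}(\mathbb{O}\oplus\mathbb{O})$ generated by the $\mathbb{R}$-linear maps $$g(r,u)\begin{pmatrix}x\\ y\end{pmatrix}=\begin{pmatrix}rx+\bar u y\\ ux-ry\end{pmatrix},\qquad r\in\mathbb{R},\ u\in\mathbb{O},\ r^2+|u|^2=1.$$ For such $(r,u)$, $\rho_{\mathbb{O}}(r,u)\in\mathrm{End}_{\mathbb{R}}(\mathbb{R}\oplus\mathbb{O})$ is the linear map $$\rho_{\mathbb{O}}(r,u)=2\begin{pmatrix}r\\ \bar u\end{pmatrix}\begin{pmatrix}r\\ \bar u\end{pmatrix}^t-I_9,\qquad\text{where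 }\begin{pmatrix}r\\ \bar u\end{pmatrix}^t\begin{pmatrix}s\\ w\end{pmatrix}=rs+\langle\bar u,w\rangle\text{ for }(s,w)\in\mathbb{R}\oplus\mathbb{O}.$$ *)

(* Defs.v *)
From mathcomp Require Import all_boot all_order all_algebra.
From mathcomp Require Import all_classical all_reals all_analysis.

Set Implicit Arguments.
Unset Strict Implicit.
Unset Printing Implicit Defensive.

Import Order.TTheory GRing.Theory Num.Theory.
Import numFieldNormedType.Exports.

Local Open Scope classical_set_scope.
Local Open Scope ring_scope.

(* The octonions are obtained from R by three Cayley-Dickson doublings,
     (a, b) (c, d) = (a c - d^* b, d a + b c^* ),   (a, b)^* = (a^*, - b),
   a pair (a, b) being stored as the column [col_mx a b].  The resulting
   coordinates are orthonormal (lemma [oinnerE]). *)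
Section CayleyDickson.
Variables (R : realType) (n : nat).
Variables (mul : 'cV[R]_n -> 'cV[R]_n -> 'cV[R]_n) (conj : 'cV[R]_n -> 'cV[R]_n).

Definition cd_mul (x y : 'cV[R]_(n + n)) : 'cV[R]_(n + n) :=
  let a := usubmx x in let b := dsubmx x in
  let c := usubmx y in let d := dsubmx y in
  col_mx (mul a c - mul (conj d) b) (mul d a + mul b (conj c)).

Definition cd_conj (x : 'cV[R]_(n + n)) : 'cV[R]_(n + n) :=
  col_mx (conj (usubmx x)) (- dsubmx x).

End CayleyDickson.

Section Octonions.
Variable R : realType.

Definition real_mul (x y : 'cV[R]_1) : 'cV[R]_1 := x *m y.
Definition real_conj (x : 'cV[R]_1) : 'cV[R]_1 := x.

Definition complex_mul : 'cV[R]_2 -> 'cV[R]_2 -> 'cV[R]_2 :=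
  cd_mul real_mul real_conj.
Definition complex_conj : 'cV[R]_2 -> 'cV[R]_2 := cd_conj real_conj.

Definition quat_mul : 'cV[R]_4 -> 'cV[R]_4 -> 'cV[R]_4 :=
  cd_mul complex_mul complex_conj.
Definition quat_conj : 'cV[R]_4 -> 'cV[R]_4 := cd_conj complex_conj.

Definition omul : 'cV[R]_8 -> 'cV[R]_8 -> 'cV[R]_8 :=
  cd_mul quat_mul quat_conj.
Definition oconj : 'cV[R]_8 -> 'cV[R]_8 := cd_conj quat_conj.

Definition oRe (x : 'cV[R]_8) : R := x 0 0.
Definition oinner (x y : 'cV[R]_8) : R := oRe (omul x (oconj y)).
Definition onorm (x : 'cV[R]_8) : R := Num.sqrt (oinner x x).

End Octonions.

(* The matrix, in the standard bases and acting on columns, of a linear map. *)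
Definition mx_of_fun (R : realType) (m n : nat)
    (f : 'cV[R]_n -> 'cV[R]_m) : 'M[R]_(m, n) :=
  \matrix_(i, j) f (delta_mx j 0) i 0.

Section Spin9.
Variable R : realType.

(* End_R (O + O) is identified with 'M[R]_(8 + 8), and (x, y) with
   [col_mx x y]. *)
Definition spin_gen_fun (r : R) (u : 'cV[R]_8) (p : 'cV[R]_(8 + 8)) :
    'cV[R]_(8 + 8) :=
  let x := usubmx p in let y := dsubmx p in
  col_mx (r *: x + omul (oconj u) y) (omul u x - r *: y).

Definition spin_gen (r : R) (u : 'cV[R]_8) : 'M[R]_(8 + 8) :=
  mx_of_fun (spin_gen_fun r u).

Definition matrix_subgroup (n : nat) (H : set 'M[R]_n) : Prop :=
  [/\ H 1%:M,
      forall A B, H A -> H B -> H (A *m B) &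
      forall A, H A -> A \in unitmx /\ H (invmx A)].

Definition generated_subgroup (n : nat) (G : set 'M[R]_n) : set 'M[R]_n :=
  smallest (@matrix_subgroup n) G.

Definition Spin9hat : set 'M[R]_(8 + 8) :=
  generated_subgroup
    [set A | exists r u, r ^+ 2 + onorm u ^+ 2 = 1 /\ A = spin_gen r u].

Definition SO (n : nat) : set 'M[R]_n :=
  [set A | A^T *m A = 1%:M /\ \det A = 1].

(* [v^T] is the functional (s, w) |-> r s + <oconj u, w>, see [rho_rowE]. *)
Definition rho (r : R) (u : 'cV[R]_8) : 'M[R]_(1 + 8) :=
  let v : 'cV[R]_(1 + 8) := col_mx r%:M (oconj u) in
  2%:R *: (v *m v^T) - 1%:M.

End Spin9.

Arguments Spin9hat R _ : clear implicits.
Arguments SO R n _ : clear implicits.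

Section Covering.
Variables (X Y : topologicalType).

Definition rel_open (T : topologicalType) (A U : set T) : Prop :=
  exists2 O, open O & U = A `&` O.

(* For f continuous on V: f restricts to a homeomorphism from V onto U. *)
Definition homeo_on (f : X -> Y) (V : set X) (U : set Y) : Prop :=
  set_bij V U f /\
  exists2 g : Y -> X, {within U, continuous g} & forall x, V x -> g (f x) = x.

Definition covering_map (k : nat) (E : set X) (B : set Y) (f : X -> Y) : Prop :=
  [/\ {within E, continuous f},
      set_fun E B f &
      forall b, B b -> exists U : set Y,
        [/\ rel_open B U, U b &
            exists V : 'I_k -> set X,
              [/\ forall i, rel_open E (V i),
                  trivIset setT V,
                  E `&` f @^-1` U = \bigcup_i V i &
                  forall i, homeo_on f (V i) U]]].

End Covering.

Section Checks.
Variable R : realType.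

Lemma mx_of_funE (m n : nat) (f : 'cV[R]_n -> 'cV[R]_m) (v : 'cV[R]_n) :
  linear f -> mx_of_fun f *m v = f v.
Proof.
move=> lf; have f0 : f 0 = 0.
  by have := lf (-1) 0 0; rewrite scaler0 addr0 scaleN1r addNr.
have fD x y : f (x + y) = f x + f y by rewrite -{1}[x]scale1r lf scale1r.
have fZ a x : f (a *: x) = a *: f x by rewrite -[a *: x]addr0 lf f0 addr0.
have -> : f v = \sum_j v j 0 *: f (delta_mx j 0).
  rewrite {1}(matrix_sum_delta v) (big_morph f fD f0).
  by apply: eq_bigr => j _; rewrite big_ord1 fZ.
apply/matrixP => i k; rewrite ord1 mxE summxE; apply: eq_bigr => j _.
by rewrite !mxE mulrC.
Qed.

Let dot (n : nat) (x y : 'cV[R]_n) : R := (x^T *m y) 0 0.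

Let cd_ok (n : nat) (mul : 'cV[R]_n -> 'cV[R]_n -> 'cV[R]_n)
    (conj : 'cV[R]_n -> 'cV[R]_n) :=
  [/\ forall x, linear (mul x), forall y, linear (mul^~ y), linear conj,
      forall x y (i : 'I_n), i = 0%N :> nat -> mul x (conj y) i 0 = dot x y &
      forall x y (i : 'I_n), i = 0%N :> nat -> mul (conj x) y i 0 = dot x y].

Let linN (m n : nat) (f : 'cV[R]_n -> 'cV[R]_m) : linear f ->
  (forall x, f (- x) = - f x).
Proof.
move=> lf x; have f0 : f 0 = 0.
  by have := lf (-1) 0 0; rewrite scaler0 addr0 scaleN1r addNr.
by have := lf (-1) x 0; rewrite f0 !addr0 !scaleN1r.
Qed.

Let dotC (n : nat) (x y : 'cV[R]_n) : dot x y = dot y x.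
Proof. by rewrite /dot !mxE; apply: eq_bigr => i _; rewrite !mxE mulrC. Qed.

Let dot_split (m n : nat) (x y : 'cV[R]_(m + n)) :
  dot x y = dot (usubmx x) (usubmx y) + dot (dsubmx x) (dsubmx y).
Proof.
by rewrite /dot -{1}[x]vsubmxK -{1}[y]vsubmxK tr_col_mx mul_row_col mxE.
Qed.

Let col_mx00 (n : nat) (i : 'I_(n + n)) : i = 0%N :> nat ->
  exists2 j : 'I_n, j = 0%N :> nat &
  forall x y : 'cV[R]_n, col_mx x y i 0 = x j 0.
Proof.
move=> i0; have n0 : (0 < n)%N by case: n i i0 => [|//] [].
exists (Ordinal n0) => // x y.
have -> : i = lshift n (Ordinal n0) by apply/val_inj.
by rewrite col_mxEu.
Qed.

Let cd_step (n : nat) (mul : 'cV[R]_n -> 'cV[R]_n -> 'cV[R]_n)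
    (conj : 'cV[R]_n -> 'cV[R]_n) :
  cd_ok mul conj -> cd_ok (cd_mul mul conj) (cd_conj conj).
Proof.
case=> lr ll lc h1 h2; split.
- move=> x a y z; rewrite /cd_mul !linearP /= !lc !lr !ll.
  rewrite scale_col_mx add_col_mx; congr col_mx.
    by rewrite opprD addrACA scalerBr.
  by rewrite addrACA scalerDr.
- move=> y a x z; rewrite /cd_mul !linearP /= !lr !ll.
  rewrite scale_col_mx add_col_mx; congr col_mx.
    by rewrite opprD addrACA scalerBr.
  by rewrite addrACA scalerDr.
- move=> a x y; rewrite /cd_conj !linearP /= lc.
  by rewrite scale_col_mx add_col_mx scalerN.
- move=> x y i i0; rewrite /cd_mul /cd_conj !(col_mxKu, col_mxKd) /=.
  have [j j0 ->] := col_mx00 i0.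
  rewrite dot_split -(h1 _ _ j j0) mxE (linN lc) (linN (ll _)) opprK.
  by rewrite h2 // dotC.
- move=> x y i i0; rewrite /cd_mul /cd_conj !(col_mxKu, col_mxKd) /=.
  have [j j0 ->] := col_mx00 i0.
  rewrite dot_split -(h2 _ _ j j0) mxE (linN (lr _)) opprK.
  by rewrite !h2 // (dotC (dsubmx y)).
Qed.

Let octonion_ok : cd_ok (@omul R) (@oconj R).
Proof.
suff h : cd_ok (@real_mul R) (@real_conj R).
  exact: (cd_step (cd_step (cd_step h))).
split=> //.
- by move=> x a y z; rewrite /real_mul mulmxDr -scalemxAr.
- by move=> x a y z; rewrite /real_mul mulmxDl -scalemxAl.
- by move=> x y i _; rewrite /real_mul /real_conj /dot ord1 !mxE !big_ord1 mxE.
- by move=> x y i _; rewrite /real_mul /real_conj /dot ord1 !mxE !big_ord1 mxE.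
Qed.

Lemma omul_linearr (x : 'cV[R]_8) : linear (omul x).
Proof. by case: octonion_ok. Qed.

Lemma omul_linearl (y : 'cV[R]_8) : linear ((@omul R)^~ y).
Proof. by case: octonion_ok. Qed.

Lemma oconj_linear : linear (@oconj R).
Proof. by case: octonion_ok. Qed.

Lemma oinnerE (x y : 'cV[R]_8) : oinner x y = (x^T *m y) 0 0.
Proof. by case: octonion_ok => _ _ _ h _; apply: h. Qed.

Lemma spin_genE (r : R) (u x y : 'cV[R]_8) :
  spin_gen r u *m col_mx x y =
  col_mx (r *: x + omul (oconj u) y) (omul u x - r *: y).
Proof.
rewrite mx_of_funE /spin_gen_fun ?col_mxKu ?col_mxKd // => a p q.
rewrite !linearP /= !omul_linearr scale_col_mx add_col_mx.
rewrite !scalerDr; congr (col_mx _ _); exact: addrACA.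
Qed.

Lemma rho_rowE (r s : R) (u w : 'cV[R]_8) :
  (col_mx r%:M (oconj u))^T *m (col_mx s%:M w : 'cV[R]_(1 + 8)) =
  (r * s + oinner (oconj u) w)%:M.
Proof.
rewrite tr_col_mx mul_row_col tr_scalar_mx -scalar_mxM raddfD /=.
by congr (_ + _); rewrite oinnerE -mx11_scalar.
Qed.

End Checks.

(* Main.v *)
From HB Require Import structures.
Require Import Defs.
From mathcomp Require Import all_boot all_order all_algebra.
From mathcomp Require Import all_classical all_reals all_analysis.
From mathcomp Require Import ring lra.
Import Order.TTheory GRing.Theory Num.Theory.
Import numFieldNormedType.Exports.
Set Implicit Arguments.
Unset Strict Implicit.
Unset Printing Implicit Defensive.
Local Open Scope classical_set_scope.
Local Open Scope ring_scope.

(* The generators [gamma v := spin_gen r u], for the vector [v = (r, u^* )] of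
   R^9, are symmetric and satisfy the Clifford relation [gamma v ^ 2 = |v|^2];
   hence conjugation by [gamma v], [|v| = 1], maps [gamma w] to
   [gamma (2 <v, w> v - w)], and Gamma is the action of Spin9hat by conjugation
   on the space of all [gamma w].  A matrix commuting with every [gamma w] is
   scalar, because the nucleus of the octonions is R; this gives the kernel.
   Surjectivity is Cartan-Dieudonne: up to sign, an orthogonal matrix is a
   product of the [rho r u], which are opposites of reflections, and -1 has
   determinant -1 in odd dimension.
   For the covering, average a lift B of b against the intertwining relation of
   Q: this gives a polynomial F in Q, with F (Q) = k tr (S^T B) S for each of
   the two lifts S of Q.  Over the open set where tr (F (Q)^T B) > 0 the sign
   of tr (S^T B) separates the two sheets, and F, normalized, is a continuous
   section onto each of them. *)

(** * Continuity of matrix operations *)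

Section MatrixContinuity.
Variables (R : realType) (T : topologicalType).

(** A neighbourhood of a matrix contains a product of neighbourhoods of its finitely many
    entries. *)
Lemma continuous_mx m p (f : T -> 'M[R]_(m, p)) :
  (forall i j, continuous (fun t => f t i j)) -> continuous f.
Proof.
move=> fc t A [P Pf sPA]; apply: filterS sPA _.
apply: filter_forall => i; apply: filter_forall => j.
exact: (fc i j t (P i j) (Pf i j)).
Qed.

Lemma continuous_entry m p (f : T -> 'M[R]_(m, p)) i j :
  continuous f -> continuous (fun t => f t i j).
Proof.
move=> fc t; apply: (@continuous_comp _ _ _ f (fun M : 'M[R]_(m, p) => M i j)).
  exact: fc.
exact: coord_continuous.
Qed.

Lemma continuous_sumr (I : finType) (f : I -> T -> R) :
  (forall i, continuous (f i)) -> continuous (fun t => \sum_i f i t).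
Proof.
move=> fc; elim: (index_enum I) => [|i r IH].
  by under [X in continuous X]funext do rewrite big_nil; exact: cst_continuous.
under [X in continuous X]funext do rewrite big_cons.
by move=> t; apply: cvgD; [exact: fc | exact: IH].
Qed.

Lemma continuous_mulr (f g : T -> R) :
  continuous f -> continuous g -> continuous (fun t => f t * g t).
Proof. by move=> fc gc t; apply: cvgM; [exact: fc | exact: gc]. Qed.

Lemma continuous_mulmx m p q (f : T -> 'M[R]_(m, p)) (g : T -> 'M[R]_(p, q)) :
  continuous f -> continuous g -> continuous (fun t => f t *m g t).
Proof.
move=> fc gc; apply: continuous_mx => i j.
under [X in continuous X]funext do rewrite mxE.
apply: continuous_sumr => k.
by apply: continuous_mulr; exact: continuous_entry.
Qed.

Lemma continuous_addmx m p (f g : T -> 'M[R]_(m, p)) :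
  continuous f -> continuous g -> continuous (fun t => f t + g t).
Proof. by move=> fc gc t; apply: cvgD; [exact: fc | exact: gc]. Qed.

Lemma continuous_trmx m p (f : T -> 'M[R]_(m, p)) :
  continuous f -> continuous (fun t => (f t)^T).
Proof.
move=> fc; apply: continuous_mx => i j.
under [X in continuous X]funext do rewrite mxE.
exact: continuous_entry.
Qed.

Lemma continuous_mxtrace m (f : T -> 'M[R]_m) :
  continuous f -> continuous (fun t => \tr (f t)).
Proof. by move=> fc; apply: continuous_sumr => i; exact: continuous_entry. Qed.

(** Expanding in matrix units makes each entry of [g (f t)] a fixed linear combination of the
    entries of [f t]. *)
Lemma continuous_linear_mx m p m' p' (f : T -> 'M[R]_(m, p))
    (g : {linear 'M[R]_(m, p) -> 'M[R]_(m', p')}) :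
  continuous f -> continuous (fun t => g (f t)).
Proof.
move=> fc; apply: continuous_mx => i j.
have E t : g (f t) i j = \sum_a \sum_b f t a b * g (delta_mx a b) i j.
  rewrite {1}[f t]matrix_sum_delta linear_sum summxE; apply: eq_bigr => a _.
  rewrite linear_sum summxE; apply: eq_bigr => b _.
  by rewrite linearZ mxE.
under [X in continuous X]funext do rewrite E.
apply: continuous_sumr => a; apply: continuous_sumr => b.
by apply: continuous_mulr; [exact: continuous_entry | exact: cst_continuous].
Qed.

(** Serves the local sections of the covering, which are normalized in this way; positivity is asked
    only at the point [t] itself. *)
Lemma continuous_scale_sqrtV m p (c : R) (f : T -> R)
    (g : T -> 'M[R]_(m, p)) t :
  continuous f -> continuous g -> 0 < f t ->
  {for t, continuous (fun t => (c / Num.sqrt (f t)) *: g t)}.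
Proof.
move=> fc gc ft; apply: cvgZ; last exact: gc.
apply: cvgM; first exact: cvg_cst.
apply: cvgV; first by rewrite gt_eqF // sqrtr_gt0.
by apply: continuous_comp; [exact: fc | exact: sqrt_continuous].
Qed.

End MatrixContinuity.

(** * Half-turns *)

Section Dot.
Variables (R : realType) (n : nat).
Implicit Types (v w : 'cV[R]_n) (Q : 'M[R]_n).

Definition dot v w : R := (v^T *m w) 0 0.

Lemma dotE v w : v^T *m w = (dot v w)%:M.
Proof. exact: mx11_scalar. Qed.

Lemma dotC v w : dot v w = dot w v.
Proof. by rewrite /dot -[v^T *m w]trmxK trmx_mul trmxK mxE. Qed.

Lemma dotDl u v w : dot (u + v) w = dot u w + dot v w.
Proof. by rewrite /dot linearD mulmxDl mxE. Qed.

Lemma dotDr u v w : dot u (v + w) = dot u v + dot u w.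
Proof. by rewrite /dot mulmxDr mxE. Qed.

Lemma dotZl k v w : dot (k *: v) w = k * dot v w.
Proof. by rewrite /dot linearZ -scalemxAl mxE. Qed.

Lemma dotZr k v w : dot v (k *: w) = k * dot v w.
Proof. by rewrite /dot -scalemxAr mxE. Qed.

Lemma dotBl u v w : dot (u - v) w = dot u w - dot v w.
Proof. by rewrite dotDl -scaleN1r dotZl mulN1r. Qed.

Lemma dotBr u v w : dot u (v - w) = dot u v - dot u w.
Proof. by rewrite dotDr -scaleN1r dotZr mulN1r. Qed.

Lemma dot_orth Q v w : Q^T *m Q = 1%:M -> dot (Q *m v) (Q *m w) = dot v w.
Proof. by move=> QQ; rewrite /dot trmx_mul mulmxA -(mulmxA _ Q^T) QQ mulmx1. Qed.

Lemma dot_ge0 v : 0 <= dot v v.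
Proof. by rewrite /dot mxE; apply: sumr_ge0 => i _; rewrite mxE -expr2 sqr_ge0. Qed.

Lemma dot_eq0 v : dot v v = 0 -> v = 0.
Proof.
rewrite /dot mxE => /eqP; rewrite psumr_eq0; last first.
  by move=> i _; rewrite mxE -expr2 sqr_ge0.
move=> /allP v0; apply/matrixP => i j; rewrite ord1 [RHS]mxE.
by have := v0 i (mem_index_enum i); rewrite mxE mulf_eq0 orbb => /eqP.
Qed.

Definition ev (i : 'I_n) : 'cV[R]_n := delta_mx i 0.

Lemma dot_ev i v : dot (ev i) v = v i 0.
Proof. by rewrite /dot trmx_delta -rowE mxE. Qed.

Lemma mul_ev Q i j : (Q *m ev j) i 0 = Q i j.
Proof. by rewrite -colE mxE. Qed.

Lemma dot_ev_ev i j : dot (ev i) (ev j) = (i == j)%:R.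
Proof. by rewrite dot_ev mxE eqxx andbT. Qed.

Lemma ev_sum v : v = \sum_i v i 0 *: ev i.
Proof. by rewrite {1}(matrix_sum_delta v); apply: eq_bigr => i _; rewrite big_ord1. Qed.

(* For a unit vector [v], [halfturn v] is the identity on the line of [v] and
   [-1] on its orthogonal complement, that is, minus the reflection along [v]. *)
Definition halfturn v : 'M[R]_n := 2%:R *: (v *m v^T) - 1%:M.

Lemma halfturnE v w : halfturn v *m w = (2 * dot v w) *: v - w.
Proof.
rewrite /halfturn mulmxBl mul1mx -scalemxAl -mulmxA dotE mul_mx_scalar.
by rewrite scalerA.
Qed.

Lemma halfturn_tr v : (halfturn v)^T = halfturn v.
Proof. by rewrite /halfturn linearB linearZ /= trmx_mul trmxK trmx1. Qed.

Lemma halfturnK v : dot v v = 1 -> halfturn v *m halfturn v = 1%:M.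
Proof.
move=> vv; rewrite {2}/halfturn mulmxBr mulmx1 -scalemxAr mulmxA halfturnE vv.
by rewrite mulr1 mulmxBl -scalemxAl scalerBr /halfturn; apply/matrixP => i j; rewrite !mxE; ring.
Qed.

Lemma halfturn_orth v : dot v v = 1 -> (halfturn v)^T *m halfturn v = 1%:M.
Proof. by move=> vv; rewrite halfturn_tr halfturnK. Qed.

(* Both block factorizations of [block_mx 1 v (c v^T) 1]. *)
Lemma det_rank1_update (c : R) v :
  \det (1%:M - c *: (v *m v^T)) = 1 - c * dot v v.
Proof.
have : block_mx 1%:M v 0 1%:M *m block_mx (1%:M - c *: (v *m v^T)) 0 (c *: v^T) 1%:M
  = block_mx 1%:M 0 (c *: v^T) 1%:M *m block_mx 1%:M v 0 (1 - c * dot v v)%:M.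
  rewrite !mulmx_block !(mul1mx, mulmx1, mul0mx, mulmx0, addr0, add0r).
  rewrite -scalemxAr -scalemxAl subrK dotE; congr block_mx.
  by rewrite raddfB /= scale_scalar_mx addrC subrK.
move/(congr1 determinant); rewrite !det_mulmx !det_ublock !det_lblock.
by rewrite !det1 !mulr1 !mul1r det_scalar1.
Qed.

(** Since [halfturn v] is minus a reflection, its determinant is [(-1) ^ n * (1 - 2)]. *)
Lemma halfturn_det v : odd n -> dot v v = 1 -> \det (halfturn v) = 1.
Proof.
move=> on vv; rewrite /halfturn -opprB -scaleN1r detZ det_rank1_update vv.
by rewrite -signr_odd on; ring.
Qed.

End Dot.

(** * The spin group of an irreducible Clifford module *)

Section Clifford.
Variables (R : realType) (n N : nat) (gamma : 'cV[R]_n -> 'M[R]_N).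
Hypothesis gamma_linear : linear gamma.
Hypothesis gamma_tr : forall v, (gamma v)^T = gamma v.
Hypothesis gamma_sqr : forall v, gamma v *m gamma v = (dot v v)%:M.
Hypothesis gamma_irr : forall A,
  (forall v, A *m gamma v = gamma v *m A) -> exists c, A = c%:M.
Hypothesis n_odd : odd n.
Hypothesis n_gt1 : (1 < n)%N.
Hypothesis N_gt0 : (0 < N)%N.
Implicit Types (u v w : 'cV[R]_n) (Q : 'M[R]_n) (A B S X : 'M[R]_N).

HB.instance Definition _ := GRing.isLinear.Build R _ _ _ gamma gamma_linear.

(** Polarization of [gamma_sqr] at [v + w]. *)
Lemma gamma_anti v w :
  gamma v *m gamma w + gamma w *m gamma v = (2 * dot v w)%:M.
Proof.
have := gamma_sqr (v + w); rewrite linearD mulmxDl !mulmxDr !gamma_sqr.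
rewrite dotDl !dotDr (dotC w v) !raddfD /= => /matrixP E.
apply/matrixP => i j; have := E i j; rewrite !mxE.
by case: (i == j) => /=; rewrite ?mulr1n ?mulr0n; lra.
Qed.

Lemma gamma_conj v w : dot v v = 1 ->
  gamma v *m gamma w = gamma (halfturn v *m w) *m gamma v.
Proof.
move=> vv; rewrite halfturnE linearB linearZ mulmxBl -scalemxAl gamma_sqr vv.
by rewrite scale_scalar_mx mulr1 -gamma_anti addrK.
Qed.

Lemma tr_gamma_gamma v w : \tr (gamma v *m gamma w) = dot v w * N%:R.
Proof.
have /(congr1 mxtrace) := gamma_anti v w.
by rewrite mxtraceD (mxtrace_mulC (gamma w)) mxtrace_scalar -mulr_natr; lra.
Qed.

(** * The group generated by the unit vectors, and lifts of orthogonal matrices *)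

Definition Spin : set 'M[R]_N :=
  generated_subgroup [set A | exists v, dot v v = 1 /\ A = gamma v].

(** The action by conjugation, written as an intertwining relation free of inverses. Orthogonality
    turns inverses into transposes and later cuts scalars down to signs. *)
Definition lifts A Q := [/\ A^T *m A = 1%:M, Q^T *m Q = 1%:M &
  forall w, A *m gamma w = gamma (Q *m w) *m A].

(* The entries of [Q] when [lifts A Q], see [lifts_vecrep]; a formula polynomial
   in [A] makes continuity immediate. *)
Definition vecrep A : 'M[R]_n :=
  \matrix_(i, j) (N%:R^-1 * \tr (gamma (ev R i) *m A *m gamma (ev R j) *m A^T)).

Let N_neq0 : N%:R != 0 :> R.
Proof. by rewrite pnatr_eq0 -lt0n. Qed.

(** Moving [A] past [gamma (ev R j)] and cancelling [A *m A^T] leaves the trace of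
    [gamma (ev R i) *m gamma (Q *m ev R j)], which is [N * Q i j]. *)
Lemma lifts_vecrep A Q : lifts A Q -> vecrep A = Q.
Proof.
case=> AA _ AQ; apply/matrixP => i j; rewrite mxE -(mulmxA _ A) AQ !mulmxA.
rewrite -mulmxA (mulmx1C AA) mulmx1 tr_gamma_gamma dot_ev mul_ev.
by rewrite mulrC mulfK.
Qed.

Lemma lifts1 : lifts 1%:M 1%:M.
Proof. by split=> [||w]; rewrite ?trmx1 ?mul1mx // mulmx1. Qed.

Lemma lifts_mul A B Q P : lifts A Q -> lifts B P -> lifts (A *m B) (Q *m P).
Proof.
move=> [AA QQ AQ] [BB PP BP]; split.
- by rewrite trmx_mul mulmxA -(mulmxA _ A^T) AA mulmx1.
- by rewrite trmx_mul mulmxA -(mulmxA _ Q^T) QQ mulmx1.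
- by move=> w; rewrite -mulmxA BP !mulmxA AQ !mulmxA.
Qed.

Lemma lifts_tr A Q : lifts A Q -> lifts A^T Q^T.
Proof.
move=> [AA QQ AQ]; split; rewrite ?trmxK; try exact: mulmx1C.
move=> w; have E : gamma w *m A = A *m gamma (Q^T *m w).
  by rewrite AQ mulmxA (mulmx1C QQ) mul1mx.
rewrite -[LHS]mulmx1 -(mulmx1C AA) mulmxA -(mulmxA _ (gamma w)) E.
by rewrite !mulmxA AA mul1mx.
Qed.

Lemma lifts_opp A Q : lifts A Q -> lifts (- A) Q.
Proof.
move=> [AA QQ AQ]; split=> // [|w]; first by rewrite [(- A)^T]linearN mulNmx mulmxN opprK.
by rewrite mulNmx mulmxN AQ.
Qed.

Lemma lifts_gamma v : dot v v = 1 -> lifts (gamma v) (halfturn v).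
Proof.
move=> vv; split; first by rewrite gamma_tr gamma_sqr vv.
  exact: halfturn_orth.
by move=> w; apply: gamma_conj.
Qed.

Lemma lifts_invmx A Q : lifts A Q -> A \in unitmx /\ invmx A = A^T.
Proof.
case=> AA _ _; have [uT uA] := mulmx1_unit AA; split=> //.
by rewrite -[LHS]mul1mx -AA mulmxK.
Qed.

Lemma Spin1 : Spin 1%:M.
Proof. by move=> H [[]]. Qed.

Lemma Spin_mul A B : Spin A -> Spin B -> Spin (A *m B).
Proof.
move=> hA hB H [HH sub]; have [_ HM _] := HH.
by apply: HM; [exact: hA | exact: hB].
Qed.

Lemma Spin_gamma v : dot v v = 1 -> Spin (gamma v).
Proof. by move=> vv H [_ sub]; apply: sub; exists v. Qed.

(** The matrices that lift some element of [SO R n] form a subgroup containing the generators;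
    [n_odd] enters through [halfturn_det]. *)
Lemma Spin_lifts A : Spin A -> SO R n (vecrep A) /\ lifts A (vecrep A).
Proof.
suff: Spin `<=` [set A | exists2 Q, SO R n Q & lifts A Q].
  by move=> sub /sub[Q SQ AQ]; rewrite (lifts_vecrep AQ).
apply: smallest_sub; last first.
  move=> _ [v [vv ->]]; exists (halfturn v); last exact: lifts_gamma.
  by split; [exact: halfturn_orth | exact: halfturn_det].
split=> [|A' B [Q [_ dQ] AQ] [P [_ dP] BP]|A' [Q [_ dQ] AQ]].
- by exists 1%:M; [split; rewrite ?trmx1 ?mulmx1 ?det1 | exact: lifts1].
- exists (Q *m P); last exact: lifts_mul.
  by split; [case: (lifts_mul AQ BP) | rewrite det_mulmx dQ dP mulr1].
- have [uA ->] := lifts_invmx AQ; split=> //; exists Q^T; last exact: lifts_tr.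
  by split; [case: (lifts_tr AQ) | rewrite det_tr].
Qed.

Lemma vecrep_mul A B : Spin A -> Spin B ->
  vecrep (A *m B) = vecrep A *m vecrep B.
Proof.
move=> /Spin_lifts[_ lA] /Spin_lifts[_ lB].
exact: lifts_vecrep (lifts_mul lA lB).
Qed.

Lemma vecrep_gamma v : dot v v = 1 -> vecrep (gamma v) = halfturn v.
Proof. by move=> vv; apply/lifts_vecrep/lifts_gamma. Qed.

(** * The kernel *)

Lemma lifts_scalar A : lifts A 1%:M -> A = 1%:M \/ A = - 1%:M.
Proof.
case=> AA _ AQ.
have [v|c Ac] := gamma_irr (A := A); first by rewrite AQ mul1mx.
(* In a diagonal entry, [A^T *m A = 1] reads [c ^ 2 = 1]. *)
have /matrixP/(_ (Ordinal N_gt0) (Ordinal N_gt0)) := AA.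
rewrite Ac tr_scalar_mx -scalar_mxM !mxE eqxx /= => /eqP.
by rewrite -expr2 sqrf_eq1 => /orP[] /eqP ->; [left | right; rewrite raddfN].
Qed.

(** Generators at two distinct basis vectors anticommute, so the square of their product is minus
    the product of their squares. This is where [n_gt1] is used. *)
Lemma SpinN1 : Spin (- 1%:M).
Proof.
pose i0 := Ordinal (ltnW n_gt1); pose i1 := Ordinal n_gt1.
have e0 : dot (ev R i0) (ev R i0) = 1 by rewrite dot_ev_ev eqxx.
have e1 : dot (ev R i1) (ev R i1) = 1 by rewrite dot_ev_ev eqxx.
have e01 := gamma_anti (ev R i0) (ev R i1).
rewrite dot_ev_ev mulr0 raddf0 in e01; move/eqP: e01; rewrite addr_eq0 => /eqP e01.
have S01 := Spin_mul (Spin_gamma e0) (Spin_gamma e1).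
have := Spin_mul S01 S01; rewrite {2}e01 mulmxN mulmxA.
by rewrite -(mulmxA (gamma _) (gamma _)) gamma_sqr e1 mulmx1 gamma_sqr e0.
Qed.

Lemma vecrep_ker :
  [set A | Spin A /\ vecrep A = 1%:M] = [set 1%:M; - 1%:M].
Proof.
apply/seteqP; split=> [A [sA A1]|A [] ->] /=.
- by have [_] := Spin_lifts sA; rewrite A1; exact: lifts_scalar.
- by split; [exact: Spin1 | exact: lifts_vecrep lifts1].
- by split; [exact: SpinN1 | exact: lifts_vecrep (lifts_opp lifts1)].
Qed.

(* Cartan-Dieudonne: one reflection makes [Q] fix one more basis vector. *)
Lemma lifts_exist Q : Q^T *m Q = 1%:M ->
  exists2 A, Spin A & lifts A Q \/ lifts A (- Q).
Proof.
(* [d] bounds the indices of the basis vectors that [Q] may move. *)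
suff H d : forall Q, Q^T *m Q = 1%:M ->
    (forall i : 'I_n, (d <= i)%N -> Q *m ev R i = ev R i) ->
    exists2 A, Spin A & lifts A Q \/ lifts A (- Q).
  by move=> QQ; apply: (H n) => // i; rewrite leqNgt ltn_ord.
elim: d => [|d IH] {}Q QQ Qfix.
  exists 1%:M; first exact: Spin1.
  left; rewrite (_ : Q = 1%:M); first exact: lifts1.
  by apply/matrixP => i j; rewrite -mul_ev Qfix // !mxE eqxx andbT.
have [dn|nd] := ltnP d n; last first.
  apply: IH => // i di; apply: Qfix; rewrite ltn_neqAle di andbT.
  by apply: contraTneq (ltn_ord i) => <-; rewrite -leqNgt.
(* The unit vectors [Q *m e] and [e] are exchanged by the reflection along their difference [w],
   which is [- halfturn v] for [v] the normalized [w]. *)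
pose e := ev R (Ordinal dn); pose w := Q *m e - e.
have ee : dot e e = 1 by rewrite dot_ev_ev eqxx.
have QeQe : dot (Q *m e) (Q *m e) = 1 by rewrite dot_orth.
have [w0|w0] := eqVneq w 0.
  apply: IH => // i; rewrite leq_eqVlt => /predU1P[di|]; last exact: Qfix.
  by rewrite (_ : i = Ordinal dn); [exact: subr0_eq | exact/val_inj].
have ww : 0 < dot w w.
  by rewrite lt_def dot_ge0 andbT; apply: contra_neq w0; exact: dot_eq0.
pose s := Num.sqrt (dot w w); pose v := s^-1 *: w.
have s2 : s ^+ 2 = dot w w by rewrite sqr_sqrtr ?ltW.
have s0 : s != 0 by rewrite gt_eqF ?sqrtr_gt0.
have vZ x : (2 * dot v x) *: v = (2 * dot w x / dot w w) *: w.
  by rewrite dotZl scalerA -s2; congr (_ *: _); field.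
have vv : dot v v = 1.
  by rewrite dotZl dotZr -s2; field.
have [||A sA lA] := IH (- (halfturn v *m Q)).
- rewrite [(- _)^T]linearN /= mulNmx mulmxN opprK trmx_mul mulmxA.
  by rewrite -(mulmxA Q^T) halfturn_orth // mulmx1.
- move=> i; rewrite leq_eqVlt => /predU1P[di|di].
    rewrite (_ : i = Ordinal dn); last exact/val_inj.
    rewrite -/e mulNmx -mulmxA halfturnE vZ.
    have -> : 2 * dot w (Q *m e) / dot w w = 1.
      suff -> : 2 * dot w (Q *m e) = dot w w by rewrite divff ?gt_eqF.
      by rewrite /w !dotBl !dotBr (dotC e) QeQe ee; ring.
    by rewrite scale1r opprB /w opprB addrC subrK.
  rewrite mulNmx -mulmxA Qfix // halfturnE vZ.
  (* [Q] fixes [ev R i] and preserves [dot], so [Q *m e] and [e] have the same product with it. *)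
  have -> : dot w (ev R i) = 0.
    rewrite /w dotBl -{1}(Qfix _ di) dot_orth // dot_ev_ev.
    exact: subrr.
  by rewrite mulr0 mul0r scale0r sub0r opprK.
exists (gamma v *m A); first exact: Spin_mul (Spin_gamma vv) sA.
have QQ' : halfturn v *m (halfturn v *m Q) = Q.
  by rewrite mulmxA halfturnK // mul1mx.
(* The minus sign in front of [halfturn v *m Q] swaps the two alternatives. *)
case: lA => /(lifts_mul (lifts_gamma vv)); rewrite ?opprK ?mulmxN QQ'.
  by right.
by left.
Qed.

(** As [n] is odd, [- Q] has determinant -1, so no element of [Spin] lifts it. *)
Lemma SO_lifts Q : SO R n Q -> exists2 A, Spin A & lifts A Q.
Proof.
move=> [QQ dQ]; have [A sA [lA|lA]] := lifts_exist QQ; exists A => //.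
have [[_]] := Spin_lifts sA; rewrite (lifts_vecrep lA) -scaleN1r detZ dQ mulr1.
by rewrite -signr_odd n_odd /=; lra.
Qed.

Lemma vecrep_surj : set_surj Spin (SO R n) vecrep.
Proof.
by move=> Q /SO_lifts[A sA lA]; exists A => //; exact: lifts_vecrep.
Qed.

(** * Averaging against the intertwining relation *)

Definition twist Q i X : 'M[R]_N :=
  X + gamma (Q *m ev R i) *m X *m gamma (ev R i).

(** For orthogonal [Q], the term added by [twist Q i] is the image of [X] under an involution whose
    fixed points are the solutions of the intertwining relation at [ev R i]. *)
Definition twists Q (s : seq 'I_n) X : 'M[R]_N := foldr (twist Q) X s.

(** The twist at [i] creates the commutation with [gamma (ev R i)]; a later twist at another index
    [j] keeps it, because two anticommutations cancel. *)
Lemma twists1_comm s i X :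
  i \in s -> uniq s ->
  twists 1%:M s X *m gamma (ev R i) = gamma (ev R i) *m twists 1%:M s X.
Proof.
have sq j : gamma (ev R j) *m gamma (ev R j) = 1%:M.
  by rewrite gamma_sqr dot_ev_ev eqxx.
elim: s => //= j s IH; rewrite inE => /predU1P[<- _|si /andP[js us]].
  rewrite /twist mul1mx mulmxDl mulmxDr -(mulmxA _ (gamma _)) sq mulmx1.
  by rewrite !mulmxA sq mul1mx addrC.
have /eqP := gamma_anti (ev R i) (ev R j).
rewrite dot_ev_ev (_ : i == j = false); last by apply: contraNF js => /eqP <-.
rewrite mulr0 raddf0 addr_eq0 => /eqP ij.
rewrite /twist mul1mx mulmxDl mulmxDr (IH si us); congr (_ + _).
have ji : gamma (ev R j) *m gamma (ev R i) = - (gamma (ev R i) *m gamma (ev R j)).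
  by rewrite ij opprK.
rewrite -(mulmxA _ (gamma _)) ji.
rewrite mulmxN -!mulmxA (mulmxA (twists _ _ _)) (IH si us) !mulmxA ij.
by rewrite !mulNmx.
Qed.

(** For [Q = 1] a twist adds a conjugate of its argument, hence doubles the trace. *)
Lemma tr_twists1 s X : \tr (twists 1%:M s X) = 2 ^+ size s * \tr X.
Proof.
elim: s => [|i s IH] /=; first by rewrite mul1r.
rewrite /twist mul1mx mxtraceD -mulmxA mxtrace_mulC -mulmxA gamma_sqr.
by rewrite dot_ev_ev eqxx mulmx1 IH exprS; ring.
Qed.

(** The trace is doubled [n] times, then divided by the trace [N] of the identity. *)
Definition kappa : R := 2 ^+ n / N%:R.

Lemma kappa_gt0 : 0 < kappa.
Proof. by rewrite /kappa divr_gt0 ?exprn_gt0 // ltr0n. Qed.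

Lemma twists1E X : twists 1%:M (enum 'I_n) X = (kappa * \tr X)%:M.
Proof.
have [v|c Ec] := gamma_irr (A := twists 1%:M (enum 'I_n) X).
  rewrite (ev_sum v) linear_sum mulmx_sumr mulmx_suml.
  apply: eq_bigr => i _; rewrite linearZ -scalemxAl -scalemxAr.
  by rewrite twists1_comm ?mem_enum ?enum_uniq.
have := tr_twists1 (enum 'I_n) X; rewrite Ec mxtrace_scalar size_enum_ord.
move=> cN; congr _%:M.
by apply: (mulIf N_neq0); rewrite mulr_natr cN /kappa mulrAC divfK.
Qed.

(* [twists Q] averages [X] against the intertwining relation for [Q]; by
   irreducibility the result is the lift of [Q], up to a scalar. *)
Lemma lifts_twists S Q X : lifts S Q ->
  twists Q (enum 'I_n) X = (kappa * \tr (S^T *m X)) *: S.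
Proof.
case=> SS _ SQ; have SS' := mulmx1C SS.
(* The relation for [S] carries the average for [Q] to the one for [1], where [twists1E] applies. *)
have E s : twists Q s X = S *m twists 1%:M s (S^T *m X).
  elim: s => [|i s IH] /=; first by rewrite mulmxA SS' mul1mx.
  by rewrite /twist IH mulmxDr mul1mx !mulmxA SQ.
by rewrite E twists1E mul_mx_scalar.
Qed.

(** * Continuity and the covering property *)

Lemma continuous_twists s X : continuous (fun Q => twists Q s X).
Proof.
elim: s => [|i s IH] /=; first exact: cst_continuous.
apply: continuous_addmx => //; apply: continuous_mulmx; last exact: cst_continuous.
apply: continuous_mulmx => //; apply: continuous_linear_mx.
by apply: continuous_mulmx; [exact: (fun=> cvg_id) | exact: cst_continuous].
Qed.

Lemma continuous_vecrep : continuous vecrep.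
Proof.
apply: continuous_mx => i j.
under [X in continuous X]funext do rewrite mxE.
apply: continuous_mulr; first exact: cst_continuous.
apply: continuous_mxtrace; apply: continuous_mulmx.
  apply: continuous_mulmx; last exact: cst_continuous.
  by apply: continuous_mulmx; [exact: cst_continuous | exact: (fun=> cvg_id)].
by apply: continuous_trmx; exact: (fun=> cvg_id).
Qed.

Lemma vecrep_opp A : vecrep (- A) = vecrep A.
Proof.
apply/matrixP => i j; rewrite !mxE.
by rewrite [(- A)^T]linearN /= !(mulmxN, mulNmx) opprK.
Qed.

Lemma vecrep_covering : covering_map 2 Spin (SO R n) vecrep.
Proof.
split.
- exact/continuous_subspaceT/continuous_vecrep.
- by move=> A /Spin_lifts[].
move=> b /SO_lifts[B sB lB].
(* [F] and [t] depend on [Q] alone and are continuous on all matrices; for a lift [S] of [Q],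
   [0 < t Q] says that [tau S] is nonzero. *)
pose F Q := twists Q (enum 'I_n) B.
pose tau S := \tr (S^T *m B).
pose t Q := \tr ((F Q)^T *m B).
pose sg (i : 'I_2) : R := (-1) ^+ i.
have sg2 i : sg i * sg i = 1 by rewrite -expr2 sqrr_sign.
have tau_cont : continuous tau.
  apply: continuous_mxtrace; apply: continuous_mulmx; last exact: cst_continuous.
  by apply: continuous_trmx; exact: (fun=> cvg_id).
have t_cont : continuous t.
  apply: continuous_mxtrace; apply: continuous_mulmx; last exact: cst_continuous.
  by apply: continuous_trmx; exact: continuous_twists.
have F_lift S Q : lifts S Q -> F Q = (kappa * tau S) *: S.
  exact: lifts_twists.
have t_lift S Q : lifts S Q -> t Q = kappa * tau S ^+ 2.
  move=> lS; rewrite /t (F_lift _ _ lS) linearZ /= -scalemxAl mxtraceZ.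
  by rewrite -/(tau S) -mulrA.
have open_pos (T : topologicalType) (f : T -> R) :
    continuous f -> open [set x | 0 < f x].
  move=> fc; apply: (@open_comp _ _ f [set x | 0 < x]) => // x _; exact: fc.
exists (SO R n `&` [set Q | 0 < t Q]); split.
- by exists [set Q | 0 < t Q]; first exact: open_pos.
- have [SOb _] := Spin_lifts sB; rewrite (lifts_vecrep lB) in SOb; split=> //=.
  (* [tau B] is the trace [N] of the identity, so [t b] is positive. *)
  rewrite (t_lift _ _ lB) /tau; have [-> _ _] := lB.
  by rewrite mxtrace_scalar (mulr_gt0 kappa_gt0) // exprn_gt0 // ltr0n.
(* The lifts [S] and [- S] have opposite [tau], so its sign selects the sheet. *)
pose V i := Spin `&` [set S | 0 < sg i * tau S].
have U_V S : Spin S -> 0 < t (vecrep S) -> exists i, V i S.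
  move=> sS; have [_ lS] := Spin_lifts sS; rewrite (t_lift _ _ lS).
  rewrite (pmulr_rgt0 _ kappa_gt0) exprn_even_gt0 //= => tau0.
  case: (ltrgtP (tau S) 0) tau0 => // tau0 _.
    by exists ord_max; split=> //=; rewrite /sg expr1 mulN1r oppr_gt0.
  by exists ord0; split=> //=; rewrite /sg expr0 mul1r.
have V_U i S : V i S -> SO R n (vecrep S) /\ 0 < t (vecrep S).
  move=> [sS /= tau0]; have [SOS lS] := Spin_lifts sS; split=> //.
  rewrite (t_lift _ _ lS) (pmulr_rgt0 _ kappa_gt0) exprn_even_gt0 //=.
  by apply: contraTneq tau0 => ->; rewrite mulr0 ltxx.
exists V; split.
- move=> i; exists [set S | 0 < sg i * tau S] => //.
  by apply: open_pos; apply: continuous_mulr; [exact: cst_continuous |].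
- move=> i j _ _ [S [[_ /= Si] [_ /= Sj]]]; apply/val_inj.
  move: Si Sj; rewrite /sg; case: i j => [[|[|//]] ?] [[|[|//]] ?] //=;
    by rewrite expr0 expr1 => Si Sj; exfalso; lra.
- apply/seteqP; split=> [S [sS [_ /= /(U_V _ sS)[i ?]]]|S [i _ ViS]].
    by exists i.
  by split; [case: ViS | exact: V_U ViS].
(* On sheet [i], [kappa * t Q] is the square of the positive number [kappa * (sg i * tau S)], so the
   factor rescales [F Q = (kappa * tau S) *: S] to [S]. *)
move=> i; pose g Q := (sg i / Num.sqrt (kappa * t Q)) *: F Q.
have gK S : V i S -> g (vecrep S) = S.
  move=> [sS /= tau0]; have [_ lS] := Spin_lifts sS.
  rewrite /g (F_lift _ _ lS) (t_lift _ _ lS) scalerA.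
  have -> : kappa * (kappa * tau S ^+ 2) = (kappa * (sg i * tau S)) ^+ 2.
    by rewrite -[LHS]mulr1 -(sg2 i); ring.
  rewrite sqrtr_sqr ger0_norm; last by rewrite ltW // (mulr_gt0 kappa_gt0).
  rewrite -[RHS]scale1r; congr (_ *: _).
  by rewrite mulrAC mulrCA divff // gt_eqF // (mulr_gt0 kappa_gt0).
split; last first.
  exists g => //; apply: continuous_in_subspaceT => Q /[!inE] -[_ /= tQ].
  apply: (@continuous_scale_sqrtV _ _ _ _ (sg i) (fun P => kappa * t P) F).
  - by apply: continuous_mulr; [exact: cst_continuous | exact: t_cont].
  - exact: continuous_twists.
  - by rewrite (mulr_gt0 kappa_gt0).
split.
- by move=> S /V_U[].
- by move=> S S' /[!inE] VS VS' E; rewrite -(gK _ VS) -(gK _ VS') E.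
- move=> Q [/SO_lifts[S sS lS] /= tQ].
  have tauN : tau (- S) = - tau S.
    by rewrite /tau [(- S)^T]linearN /= mulNmx [LHS]linearN.
  have tau0 : sg i * tau S != 0.
    apply: contraTneq tQ => tau0; rewrite (t_lift _ _ lS) -[_ ^+ 2]mul1r.
    by rewrite -(sg2 i) -expr2 -exprMn tau0 expr0n mulr0 ltxx.
  (* As [tau] is odd and nonzero at [S], one of [S] and [- S] lies on sheet [i]; both map to [Q]. *)
  have [tau1|tau1] := ltrP 0 (sg i * tau S).
    by exists S; [split | exact: lifts_vecrep].
  exists (- S); last by rewrite vecrep_opp; exact: lifts_vecrep.
  split; last by rewrite /= tauN mulrN oppr_gt0 lt_def eq_sym tau0.
  by rewrite -[S]mul1mx -mulNmx; exact: Spin_mul SpinN1 sS.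
Qed.

Theorem clifford_spin_cover :
  [/\ (forall A, Spin A -> SO R n (vecrep A)) /\
        (forall A B, Spin A -> Spin B ->
           vecrep (A *m B) = vecrep A *m vecrep B),
      (forall v, dot v v = 1 -> vecrep (gamma v) = halfturn v),
      set_surj Spin (SO R n) vecrep,
      [set A | Spin A /\ vecrep A = 1%:M] = [set 1%:M; - 1%:M] &
      covering_map 2 Spin (SO R n) vecrep].
Proof.
split; [split|..].
- by move=> A /Spin_lifts[].
- exact: vecrep_mul.
- exact: vecrep_gamma.
- exact: vecrep_surj.
- exact: vecrep_ker.
- exact: vecrep_covering.
Qed.

End Clifford.

(** * Octonions in coordinates *)

Section Octonions.
Variable R : realType.
Implicit Types (u v w x y p : 'cV[R]_8).

Definition pair2 (a b : R) : 'cV[R]_2 := col_mx (a%:M : 'cV_1) (b%:M : 'cV_1).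

Definition quat (a b c d : R) : 'cV[R]_4 := col_mx (pair2 a b) (pair2 c d).

(** Explicit coordinates turn identities in the nonassociative product into polynomial identities
    for [ring]. *)
Definition oct (a b c d e f g h : R) : 'cV[R]_8 :=
  col_mx (quat a b c d) (quat e f g h).

Lemma pair2D a b a' b' : pair2 a b + pair2 a' b' = pair2 (a + a') (b + b').
Proof. by rewrite /pair2 (@add_col_mx _ 1 1) -!raddfD. Qed.

Lemma pair2Z k a b : k *: pair2 a b = pair2 (k * a) (k * b).
Proof. by rewrite /pair2 (@scale_col_mx _ 1 1) !scale_scalar_mx. Qed.

Lemma pair2N a b : - pair2 a b = pair2 (- a) (- b).
Proof. by rewrite -scaleN1r pair2Z !mulN1r. Qed.

Lemma quatD a b c d a' b' c' d' :
  quat a b c d + quat a' b' c' d' = quat (a + a') (b + b') (c + c') (d + d').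
Proof. by rewrite /quat (@add_col_mx _ 2 2) !pair2D. Qed.

Lemma quatZ k a b c d :
  k *: quat a b c d = quat (k * a) (k * b) (k * c) (k * d).
Proof. by rewrite /quat (@scale_col_mx _ 2 2) !pair2Z. Qed.

Lemma quatN a b c d : - quat a b c d = quat (- a) (- b) (- c) (- d).
Proof. by rewrite -scaleN1r quatZ !mulN1r. Qed.

Lemma complex_mul_pair2 a b c d :
  complex_mul (pair2 a b) (pair2 c d) = pair2 (a * c - d * b) (d * a + b * c).
Proof.
rewrite /complex_mul /cd_mul /pair2 !(col_mxKu, col_mxKd) /real_mul /real_conj.
by rewrite -!scalar_mxM -raddfB -raddfD.
Qed.

Lemma complex_conj_pair2 a b : complex_conj (pair2 a b) = pair2 a (- b).
Proof.
rewrite /complex_conj /cd_conj /pair2 !(col_mxKu, col_mxKd) /real_conj.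
by rewrite -raddfN.
Qed.

Lemma quat_mulE a b c d a' b' c' d' :
  quat_mul (quat a b c d) (quat a' b' c' d') =
  quat (a * a' - b * b' - c * c' - d * d') (a * b' + b * a' + c * d' - d * c')
       (a * c' - b * d' + c * a' + d * b') (a * d' + b * c' - c * b' + d * a').
Proof.
rewrite /quat_mul /cd_mul /quat !(col_mxKu, col_mxKd).
rewrite !(complex_conj_pair2, complex_mul_pair2, pair2N, pair2D).
by congr (col_mx (pair2 _ _) (pair2 _ _)); ring.
Qed.

Lemma quat_conjE a b c d : quat_conj (quat a b c d) = quat a (- b) (- c) (- d).
Proof.
rewrite /quat_conj /cd_conj /quat !(col_mxKu, col_mxKd).
by rewrite complex_conj_pair2 pair2N.
Qed.

Lemma octP x : exists a b c d e f g h, x = oct a b c d e f g h.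
Proof.
have split2 (z : 'cV[R]_2) : exists a b, z = pair2 a b.
  exists ((usubmx (z : 'cV_(1 + 1))) 0 0), ((dsubmx (z : 'cV_(1 + 1))) 0 0).
  by rewrite /pair2 -!mx11_scalar; exact/esym/(@vsubmxK _ 1 1).
have split4 (z : 'cV[R]_4) :
    exists a b c d, z = quat a b c d.
  have [a [b ab]] := split2 (usubmx (z : 'cV_(2 + 2))).
  have [c [d cd]] := split2 (dsubmx (z : 'cV_(2 + 2))).
  by exists a, b, c, d; rewrite /quat -ab -cd; exact/esym/(@vsubmxK _ 2 2).
have [a [b [c [d ad]]]] := split4 (usubmx (x : 'cV_(4 + 4))).
have [e [f [g [h eh]]]] := split4 (dsubmx (x : 'cV_(4 + 4))).
exists a, b, c, d, e, f, g, h.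
by rewrite /oct -ad -eh; exact/esym/(@vsubmxK _ 4 4).
Qed.

Lemma octZ k a b c d e f g h :
  k *: oct a b c d e f g h =
  oct (k * a) (k * b) (k * c) (k * d) (k * e) (k * f) (k * g) (k * h).
Proof. by rewrite /oct (@scale_col_mx _ 4 4) !quatZ. Qed.

Lemma oconj_oct a b c d e f g h :
  oconj (oct a b c d e f g h) =
  oct a (- b) (- c) (- d) (- e) (- f) (- g) (- h).
Proof.
rewrite /oconj /cd_conj /oct !(col_mxKu, col_mxKd).
by rewrite quat_conjE quatN.
Qed.

Lemma omul_oct a b c d e f g h a' b' c' d' e' f' g' h' :
  omul (oct a b c d e f g h) (oct a' b' c' d' e' f' g' h') =
  oct (a * a' - b * b' - c * c' - d * d' - e * e' - f * f' - g * g' - h * h')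
      (a * b' + b * a' + c * d' - d * c' + e * f' - f * e' - g * h' + h * g')
      (a * c' - b * d' + c * a' + d * b' + e * g' + f * h' - g * e' - h * f')
      (a * d' + b * c' - c * b' + d * a' + e * h' - f * g' + g * f' - h * e')
      (a * e' - b * f' - c * g' - d * h' + e * a' + f * b' + g * c' + h * d')
      (a * f' + b * e' - c * h' + d * g' - e * b' + f * a' - g * d' + h * c')
      (a * g' + b * h' + c * e' - d * f' - e * c' + f * d' + g * a' - h * b')
      (a * h' - b * g' + c * f' + d * e' - e * d' - f * c' + g * b' + h * a').
Proof.
rewrite /omul /cd_mul /oct !(col_mxKu, col_mxKd).
rewrite !(quat_conjE, quat_mulE, quatN, quatD).
by congr (col_mx (quat _ _ _ _) (quat _ _ _ _)); ring.
Qed.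

Lemma oinner_oct a b c d e f g h a' b' c' d' e' f' g' h' :
  oinner (oct a b c d e f g h) (oct a' b' c' d' e' f' g' h') =
  a * a' + b * b' + c * c' + d * d' + e * e' + f * f' + g * g' + h * h'.
Proof.
have dot2 a1 b1 a2 b2 :
    (pair2 a1 b1)^T *m pair2 a2 b2 = (a1 * a2 + b1 * b2)%:M.
  rewrite /pair2 (@tr_col_mx _ 1 1) (@mul_row_col _ _ 1 1) !tr_scalar_mx.
  by rewrite -!scalar_mxM -raddfD.
have dot4 a1 b1 c1 d1 a2 b2 c2 d2 :
    (quat a1 b1 c1 d1)^T *m quat a2 b2 c2 d2 =
    (a1 * a2 + b1 * b2 + (c1 * c2 + d1 * d2))%:M.
  by rewrite /quat (@tr_col_mx _ 2 2) (@mul_row_col _ _ 2 2) !dot2 -raddfD.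
rewrite oinnerE /oct (@tr_col_mx _ 4 4) (@mul_row_col _ _ 4 4) !dot4 -raddfD.
by rewrite mxE eqxx !addrA.
Qed.

Lemma oconjK : involutive (@oconj R).
Proof.
move=> x; have [a [b [c [d [e [f [g [h ->]]]]]]]] := octP x.
by rewrite !oconj_oct !opprK.
Qed.

Lemma oinner_conj x y : oinner (oconj x) (oconj y) = oinner x y.
Proof.
have [a [b [c [d [e [f [g [h ->]]]]]]]] := octP x.
have [a' [b' [c' [d' [e' [f' [g' [h' ->]]]]]]]] := octP y.
by rewrite !oconj_oct !oinner_oct !mulrNN.
Qed.

(** A form of left alternativity; it makes the squares of the generators scalar. *)
Lemma omul_conj_mul u x : omul (oconj u) (omul u x) = oinner u u *: x.
Proof.
have [a [b [c [d [e [f [g [h ->]]]]]]]] := octP u.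
have [a' [b' [c' [d' [e' [f' [g' [h' ->]]]]]]]] := octP x.
rewrite oinner_oct oconj_oct !omul_oct octZ.
by congr (oct _ _ _ _ _ _ _ _); ring.
Qed.

Lemma oinner_omul u x y : oinner (omul u x) y = oinner x (omul (oconj u) y).
Proof.
have [a [b [c [d [e [f [g [h ->]]]]]]]] := octP u.
have [a' [b' [c' [d' [e' [f' [g' [h' ->]]]]]]]] := octP x.
have [a2 [b2 [c2 [d2 [e2 [f2 [g2 [h2 ->]]]]]]]] := octP y.
by rewrite oconj_oct !omul_oct !oinner_oct; ring.
Qed.

(** * The unit and the nucleus of the octonions *)

Definition oone : 'cV[R]_8 := oct 1 0 0 0 0 0 0 0.

Lemma omul1o x : omul oone x = x.
Proof.
have [a [b [c [d [e [f [g [h ->]]]]]]]] := octP x.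
by rewrite omul_oct; congr (oct _ _ _ _ _ _ _ _); ring.
Qed.

Lemma omulo1 x : omul x oone = x.
Proof.
have [a [b [c [d [e [f [g [h ->]]]]]]]] := octP x.
by rewrite omul_oct; congr (oct _ _ _ _ _ _ _ _); ring.
Qed.

Lemma oct_inj a b c d e f g h a' b' c' d' e' f' g' h' :
  oct a b c d e f g h = oct a' b' c' d' e' f' g' h' ->
  [/\ a = a', b = b', c = c' & d = d'] /\ [/\ e = e', f = f', g = g' & h = h'].
Proof.
have inj1 (s t : R) : s%:M = t%:M :> 'M[R]_1 -> s = t.
  by move/matrixP/(_ 0 0); rewrite !mxE eqxx.
have inj2 s t s' t' : pair2 s t = pair2 s' t' -> s = s' /\ t = t'.
  by rewrite /pair2 => /(@eq_col_mx _ 1 1) [/inj1-> /inj1->].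
have inj4 r s t q r' s' t' q' : quat r s t q = quat r' s' t' q' ->
    [/\ r = r', s = s', t = t' & q = q'].
  by rewrite /quat => /(@eq_col_mx _ 2 2) [/inj2[-> ->] /inj2[-> ->]].
by rewrite /oct => /(@eq_col_mx _ 4 4) [/inj4 ? /inj4 ?].
Qed.

(* The products [(i j) p], [(i l) p] and [(j l) p] already determine [p]. *)
Lemma onucleus p :
  (forall u x, omul (omul u x) p = omul u (omul x p)) ->
  exists k, p = k *: oone.
Proof.
have [a [b [c [d [e [f [g [h ->]]]]]]]] := octP p => nuc; exists a.
have simp := (mul0r, mulr0, mul1r, mulr1, add0r, addr0, sub0r, subr0, @oppr0 R).
(* In the coordinates kept, the two sides are opposite: i j kills [e], [f], [g], [h], then i l kills
   [c], [d], and j l kills [b]. *)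
have := nuc (oct 0 1 0 0 0 0 0 0) (oct 0 0 1 0 0 0 0 0).
rewrite !omul_oct => /oct_inj[_ []]; rewrite !simp => E5 E6 E7 E8.
have := nuc (oct 0 1 0 0 0 0 0 0) (oct 0 0 0 0 1 0 0 0).
rewrite !omul_oct => /oct_inj[_ [_ _]]; rewrite !simp => F7 F8.
have := nuc (oct 0 0 1 0 0 0 0 0) (oct 0 0 0 0 1 0 0 0).
rewrite !omul_oct => /oct_inj[_ [_ _ _]]; rewrite !simp => G8.
by rewrite octZ !mulr0 mulr1; congr (oct _ _ _ _ _ _ _ _); lra.
Qed.

End Octonions.

(** * The octonionic Clifford module *)

Section OctonionClifford.
Variable R : realType.
Implicit Types (u w x y : 'cV[R]_8) (r : R) (v : 'cV[R]_(1 + 8)).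

Lemma oinner_dot x y : oinner x y = dot x y.
Proof. exact: oinnerE. Qed.

Lemma dot_omul u x y : dot (omul u x) y = dot x (omul (oconj u) y).
Proof. by have := oinner_omul u x y; rewrite !oinner_dot. Qed.

Lemma dot_oconj x y : dot (oconj x) (oconj y) = dot x y.
Proof. by have := oinner_conj x y; rewrite !oinner_dot. Qed.

Lemma onorm_sqr u : onorm u ^+ 2 = dot u u.
Proof. by rewrite sqr_sqrtr oinner_dot // dot_ge0. Qed.

Lemma dot_col_mx m n (a a' : 'cV[R]_m) (b b' : 'cV[R]_n) :
  dot (col_mx a b) (col_mx a' b') = dot a a' + dot b b'.
Proof. by rewrite /dot tr_col_mx mul_row_col mxE. Qed.

Lemma dot_scalar (a b : R) : dot (a%:M : 'cV_1) b%:M = a * b.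
Proof. by rewrite /dot tr_scalar_mx -scalar_mxM mxE eqxx. Qed.

Lemma vecP v : exists r w, v = col_mx r%:M w.
Proof. by exists (usubmx v 0 0), (dsubmx v); rewrite -mx11_scalar vsubmxK. Qed.

Lemma mulmx_col_inj (A B : 'M[R]_(8 + 8)) :
  (forall x y, A *m col_mx x y = B *m col_mx x y) -> A = B.
Proof.
move=> AB; apply/matrixP => i j.
by rewrite -(mul_ev A) -(mul_ev B) -[ev R j]vsubmxK AB.
Qed.

(** The conjugation matches the one in [rho]: when [gamma9 v] is [spin_gen r u], the half-turn of
    [v] is [rho r u]. *)
Definition gamma9 v : 'M[R]_(8 + 8) :=
  spin_gen (usubmx v 0 0) (oconj (dsubmx v)).

Lemma gamma9_spin_gen r u : gamma9 (col_mx r%:M (oconj u)) = spin_gen r u.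
Proof. by rewrite /gamma9 col_mxKu col_mxKd oconjK mxE eqxx. Qed.

Lemma gamma9E r w x y :
  gamma9 (col_mx r%:M w) *m col_mx x y =
  col_mx (r *: x + omul w y) (omul (oconj w) x - r *: y).
Proof. by rewrite /gamma9 col_mxKu col_mxKd mxE eqxx spin_genE oconjK. Qed.

Lemma omulBr u x y : omul u (x - y) = omul u x - omul u y.
Proof.
have := omul_linearr u (-1) y x; rewrite !scaleN1r (addrC (- y)) => ->.
exact: addrC.
Qed.

Lemma omul0r u : omul u 0 = 0.
Proof. by rewrite -{1}(subrr 0) omulBr subrr. Qed.

Lemma omul0l x : omul 0 x = 0.
Proof.
have /= := omul_linearl x (-1) 0 0.
by rewrite scaler0 addr0 scaleN1r addNr.
Qed.

Lemma oconj0 : oconj 0 = 0 :> 'cV[R]_8.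
Proof. by have := oconj_linear (-1) (0 : 'cV[R]_8) 0; rewrite scaler0 addr0 scaleN1r addNr. Qed.

Lemma omulDr u x y : omul u (x + y) = omul u x + omul u y.
Proof. by have := omul_linearr u 1 x y; rewrite !scale1r. Qed.

Lemma omulZr u k x : omul u (k *: x) = k *: omul u x.
Proof. by have := omul_linearr u k x 0; rewrite omul0r !addr0. Qed.

Lemma gamma9_linear : linear gamma9.
Proof.
move=> k v v'; have [r [w ->]] := vecP v; have [r' [w' ->]] := vecP v'.
apply: mulmx_col_inj => x y.
rewrite scale_col_mx add_col_mx scale_scalar_mx -raddfD mulmxDl -scalemxAl.
rewrite !gamma9E scale_col_mx add_col_mx oconj_linear !omul_linearl.
congr col_mx; rewrite scalerDl -scalerA ?scalerDr ?scalerN ?opprD.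
  exact: addrACA.
exact: addrACA.
Qed.

(** With [f] and [g] the left multiplications by an octonion and by its conjugate, this makes
    [gamma9 v] self-adjoint. *)
Lemma dot_adjoint n (f g : 'cV[R]_n -> 'cV[R]_n) r a b c d :
  (forall a b, dot (f a) b = dot a (g b)) ->
  (forall a b, dot (g a) b = dot a (f b)) ->
  dot (r *: a + f b) c + dot (g a - r *: b) d =
  dot a (r *: c + f d) + dot b (g c - r *: d).
Proof.
move=> fg gf; rewrite dotBl dotBr dotDl dotDr !dotZl !dotZr fg gf; ring.
Qed.

Lemma gamma9_tr v : (gamma9 v)^T = gamma9 v.
Proof.
have [r [w ->]] := vecP v; set A := gamma9 _.
have sym p q : dot (A *m p) q = dot p (A *m q).
  rewrite -[p]vsubmxK -[q]vsubmxK !gamma9E !dot_col_mx.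
  by apply: dot_adjoint => x y; rewrite dot_omul ?oconjK.
apply/matrixP => i j; rewrite mxE -(mul_ev A j) -(mul_ev A i).
by rewrite -!dot_ev -sym dotC.
Qed.

Lemma gamma9_sqr v : gamma9 v *m gamma9 v = (dot v v)%:M.
Proof.
have [r [w ->]] := vecP v; apply: mulmx_col_inj => x y.
rewrite -mulmxA !gamma9E mul_scalar_mx scale_col_mx omulBr omulDr !omulZr.
have wwx := omul_conj_mul (oconj w) x; rewrite oconjK oinner_conj in wwx.
rewrite wwx omul_conj_mul oinner_dot dot_col_mx dot_scalar !scalerDl.
congr col_mx; rewrite scalerDr ?scalerN !scalerA.
  by rewrite addrACA subrr addr0.
by rewrite opprD opprK addrACA subrr add0r addrC.
Qed.

(** Commuting with [gamma9] of (1, 0) makes [A] block diagonal, with blocks [f] and [h]. Commuting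
    with the vectors (0, u) gives [h (u x) = u (f x)]; then [u = 1] gives [h = f], and [x = 1] shows
    that [f] is right multiplication by [f 1], which therefore lies in the nucleus. *)
Lemma gamma9_irr (A : 'M[R]_(8 + 8)) :
  (forall v, A *m gamma9 v = gamma9 v *m A) -> exists c, A = c%:M.
Proof.
move=> comm.
pose f x := usubmx (A *m col_mx x 0); pose h y := dsubmx (A *m col_mx 0 y).
have self0 (z : 'cV[R]_8) : z = - z -> z = 0.
  move/eqP; rewrite -addr_eq0 -mulr2n -scaler_nat scaler_eq0 pnatr_eq0.
  by move/eqP.
have Ax x : A *m col_mx x 0 = col_mx (f x) 0.
  have /(congr1 (mulmx^~ (col_mx x 0))) := comm (col_mx 1%:M 0).
  rewrite -!mulmxA gamma9E -[A *m col_mx x 0]vsubmxK gamma9E.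
  rewrite !omul0r !omul0l oconj0 !omul0l !scale1r subr0 !addr0 sub0r.
  by rewrite -/(f x) -[LHS]vsubmxK => /eq_col_mx[_ /self0 ->].
have Ay y : A *m col_mx 0 y = col_mx 0 (h y).
  (* With the sign -1 the generator fixes [col_mx 0 y] and negates the upper half. *)
  have /(congr1 (mulmx^~ (col_mx 0 y))) := comm (col_mx (- 1)%:M 0).
  rewrite -!mulmxA gamma9E -[A *m col_mx 0 y]vsubmxK gamma9E.
  rewrite !omul0r !omul0l oconj0 !omul0l !scaleN1r !opprK oppr0 !addr0 !add0r.
  by rewrite -/(h y) -[LHS]vsubmxK => /eq_col_mx[/self0 -> _].
have off u x :
    gamma9 (col_mx 0%:M (oconj u)) *m col_mx x 0 = col_mx 0 (omul u x).
  by rewrite gamma9E oconjK !scale0r omul0r subr0 addr0.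
have hf u x : h (omul u x) = omul u (f x).
  have /(congr1 (mulmx^~ (col_mx x 0))) := comm (col_mx 0%:M (oconj u)).
  by rewrite -!mulmxA off Ay (Ax x) off => /eq_col_mx[].
have hE x : h x = f x by rewrite -{1}[x]omul1o hf omul1o.
have fE u : f u = omul u (f (oone R)) by rewrite -hf omulo1 hE.
have [|k fk] := @onucleus _ (f (oone R)).
  by move=> u x; rewrite -fE -hE hf -fE.
have fZ x : f x = k *: x by rewrite fE fk omulZr omulo1.
exists k; apply: mulmx_col_inj => x y.
rewrite mul_scalar_mx -[col_mx x y]addr0.
have -> : col_mx x y = col_mx x 0 + col_mx 0 y :> 'cV_(8 + 8).
  by rewrite add_col_mx addr0 add0r.
rewrite addr0 mulmxDr Ax Ay hE !fZ add_col_mx addr0 add0r.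
by rewrite add_col_mx scale_col_mx addr0 add0r.
Qed.

(** Octonion conjugation is an isometric involution, so the pairs (r, u) of norm 1 correspond to the
    unit vectors (r, u^* ). *)
Lemma Spin9hatE : Spin9hat R = Spin gamma9.
Proof.
congr generated_subgroup; apply/seteqP; split=> A /=.
  move=> [r [u [ru ->]]]; exists (col_mx r%:M (oconj u)).
  rewrite gamma9_spin_gen dot_col_mx dot_scalar dot_oconj.
  by rewrite -onorm_sqr -expr2.
move=> [v [vv ->]]; have [r [w vE]] := vecP v; exists r, (oconj w).
rewrite -gamma9_spin_gen oconjK -vE onorm_sqr dot_oconj.
by rewrite -vv vE dot_col_mx dot_scalar expr2.
Qed.

End OctonionClifford.

Theorem mainTheorem8 (R : realType) :
  exists Gamma : 'M[R]_(8 + 8) -> 'M[R]_(1 + 8),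
    [/\
        (forall A, Spin9hat R A -> SO R (1 + 8) (Gamma A)) /\
        (forall A B, Spin9hat R A -> Spin9hat R B ->
           Gamma (A *m B) = Gamma A *m Gamma B),
        (forall (r : R) (u : 'cV[R]_8), r ^+ 2 + onorm u ^+ 2 = 1 ->
           Gamma (spin_gen r u) = rho r u),
        set_surj (Spin9hat R) (SO R (1 + 8)) Gamma,
        [set A | Spin9hat R A /\ Gamma A = 1%:M] = [set 1%:M; - 1%:M] &
        covering_map 2 (Spin9hat R) (SO R (1 + 8)) Gamma].
Proof.
(* The three [erefl] check that 9 is odd, that 1 < 9 and that 0 < 16. *)
have [hom gen surj ker cover] := @clifford_spin_cover R (1 + 8) (8 + 8) _
  (@gamma9_linear R) (@gamma9_tr R) (@gamma9_sqr R) (@gamma9_irr R)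
  erefl erefl erefl.
rewrite Spin9hatE; exists (vecrep (@gamma9 R)); split=> // r u ru.
rewrite -gamma9_spin_gen gen // dot_col_mx dot_scalar dot_oconj.
by rewrite -onorm_sqr -expr2.
Qed.
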